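(* Let $\mathbb{U}$ be a universe set, let $\mathcal{F}$ and $\mathcal{G}$ be two SVN-filter bases on $\mathcal{SVN}(\mathbb{U})$ such that $\mathcal{F}$ neutrosophically meets $\mathcal{G}$, and let $$\mathcal{F} \vee \mathcal{G} = \left\{ \widetilde{F} \sqcap \widetilde{G} : \ \widetilde{F} \in \mathcal{F},\ \widetilde{G} \in \mathcal{G} \right\}$$ be the set of all neutrosophic intersections of the members of $\mathcal{F}$ and $\mathcal{G}$. Then $\mathcal{F} \vee \mathcal{G}$ is an SVN-filter base on $\mathcal{SVN}(\mathbb{U})$. Additionally, if $\mathcal{F}$ and $\mathcal{G}$ are SVN-filters on $\mathcal{SVN}(\mathbb{U})$, then $\mathcal{F} \vee \mathcal{G}$ is an SVN-filter on $\mathcal{SVN}(\mathbb{U})$ which is finer than both $\mathcal{F}$ and $\mathcal{G}$, i.e. $\mathcal{F} \subseteq \mathcal{F} \vee \mathcal{G}$ and $\mathcal{G} \subseteq \mathcal{F} \vee \mathcal{G}$.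
   Context: A single valued neutrosophic set (SVN-set) over a set $\mathbb{U}$ is a triple $\widetilde{A} = \langle \mu_A, \sigma_A, \omega_A \rangle$ of arbitrary functions $\mathbb{U} \to [0,1]$ (membership, indeterminacy, nonmembership). $\mathcal{SVN}(\mathbb{U})$ is the set of all SVN-sets over $\mathbb{U}$. Inclusion: $\widetilde{A} \sqsubseteq \widetilde{B}$ means $\mu_A(u) \le \mu_B(u)$, $\sigma_A(u) \le \sigma_B(u)$ and $\omega_A(u) \ge \omega_B(u)$ for every $u \in \mathbb{U}$. Two SVN-sets are equal if each is included in the other. Intersection: $\widetilde{A} \sqcap \widetilde{B} = \langle \min(\mu_A,\mu_B), \min(\sigma_A,\sigma_B), \max(\omega_A,\omega_B)\rangle$ (pointwise). The neutrosophic empty set is $\widetilde{\emptyset} = \langle 0,0,1\rangle$ (constant functions). Two nonempty families $\mathcal{A}, \mathcal{B} \subseteq \mathcal{SVN}(\mathbb{U})$ neutrosophically meet each other if $\widetilde{A} \sqcap \widetilde{B} \ne \widetilde{\emptyset}$ for every $\widetilde{A} \in \mathcal{A}$ and every $\widetilde{B} \in \mathcal{B}$. A nonempty family $\mathcal{F} \subseteq \mathcal{SVN}(\mathbb{U})$ is an SVN-filter base on $\mathcal{SVN}(\mathbb{U})$ if $\widetilde{\emptyset} \notin \mathcal{F}$ and for every $\widetilde{F}, \widetilde{G} \in \mathcal{F}$ there exists $\widetilde{H} \in \mathcal{F}$ with $\widetilde{H} \sqsubseteq \widetilde{F} \sqcap \widetilde{G}$. It is an SVN-filter if it is an SVN-filter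 base and for every $\widetilde{F} \in \mathcal{F}$ and every $\widetilde{A} \in \mathcal{SVN}(\mathbb{U})$ with $\widetilde{F} \sqsubseteq \widetilde{A}$ one has $\widetilde{A} \in \mathcal{F}$. *)

(* Defs.v *)
From mathcomp Require Import all_boot all_order all_algebra.
From mathcomp Require Import interval_inference.
From mathcomp Require Import boolp classical_sets reals.

Set Implicit Arguments.
Unset Strict Implicit.
Unset Printing Implicit Defensive.

Import Order.TTheory GRing.Theory Num.Theory.

Local Open Scope classical_set_scope.
Local Open Scope ring_scope.

Record svn_set (R : realType) (U : Type) := SVNSet {
  membership : U -> {i01 R} ;
  indeterminacy : U -> {i01 R} ;
  nonmembership : U -> {i01 R} }.

Section SVN.
Variables (R : realType) (U : Type).
Implicit Types A B C : svn_set R U.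
Implicit Types F G : set (svn_set R U).

Definition svn_sub A B : Prop := forall u,
  [/\ membership A u <= membership B u,
      indeterminacy A u <= indeterminacy B u &
      nonmembership A u >= nonmembership B u].

(* SVN-sets are equal when each is included in the other; this is the same as
   Leibniz equality, which is what the definitions below use. *)
Lemma svn_eqP A B : A = B <-> svn_sub A B /\ svn_sub B A.
Proof.
split=> [->|]; first by split=> u; split.
case: A B => [m i n] [m' i' n'] [AB BA].
have [em ei en] : [/\ m = m', i = i' & n = n'].
  by split; apply/funext => u; case: (AB u) (BA u) => /= ? ? ? [? ? ?];
    apply/le_anti/andP.
by rewrite em ei en.
Qed.

Definition svn_inter A B : svn_set R U := SVNSet
  (fun u => Num.min (membership A u) (membership B u))
  (fun u => Num.min (indeterminacy A u) (indeterminacy B u))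
  (fun u => Num.max (nonmembership A u) (nonmembership B u)).

Definition svn_empty : svn_set R U :=
  SVNSet (fun=> 0%:i01) (fun=> 0%:i01) (fun=> 1%:i01).

Definition svn_meets F G : Prop :=
  [/\ F !=set0, G !=set0 &
      forall A B, F A -> G B -> svn_inter A B <> svn_empty].

Definition svn_filter_base F : Prop :=
  [/\ F !=set0, ~ F svn_empty &
      forall A B, F A -> F B -> exists2 C, F C & svn_sub C (svn_inter A B)].

Definition svn_filter F : Prop :=
  svn_filter_base F /\ forall A B, F A -> svn_sub A B -> F B.

Definition svn_join F G : set (svn_set R U) :=
  [set svn_inter A B | A in F & B in G].

(* [svn_finer F G]: F is finer than G. *)
Definition svn_finer F G : Prop := G `<=` F.

End SVN.

Arguments svn_empty {R U}.

(* Main.v *)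
(* For filters, a set [C] above [A /\ B] is itself an intersection of members:
   by distributivity [C = (A /\ B) \/ C = (A \/ C) /\ (B \/ C)]. The join is finer
   than each factor by absorption, [A = A /\ (A \/ B)]. *)
Require Import Defs.
From mathcomp Require Import all_boot all_order all_algebra.
From mathcomp Require Import interval_inference.
From mathcomp Require Import boolp classical_sets reals.

Set Implicit Arguments.
Unset Strict Implicit.
Unset Printing Implicit Defensive.

Import Order.TTheory.

Local Open Scope classical_set_scope.

Section SVNLattice.
Variables (R : realType) (U : Type).
Implicit Types A B C D : svn_set R U.

(** The binary supremum for [svn_sub], dual to [svn_inter]; nonmembership takes the minimum because
    its order is reversed. It supplies the witnesses in the filter part. *)
Definition svn_union A B : svn_set R U := SVNSet
  (fun u => Num.max (membership A u) (membership B u))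
  (fun u => Num.max (indeterminacy A u) (indeterminacy B u))
  (fun u => Num.min (nonmembership A u) (nonmembership B u)).

(** Extensionality reduces each lattice identity below to one about [min] and [max] on the unit
    interval. *)
Lemma svn_setP A B :
  membership A =1 membership B -> indeterminacy A =1 indeterminacy B ->
  nonmembership A =1 nonmembership B -> A = B.
Proof.
by case: A B => [m i n] [m' i' n'] /= /funext -> /funext -> /funext ->.
Qed.

Lemma svn_interC A B : svn_inter A B = svn_inter B A.
Proof. by apply: svn_setP => u /=; rewrite (minC, maxC). Qed.

Lemma svn_interACA A B C D :
  svn_inter (svn_inter A B) (svn_inter C D) =
  svn_inter (svn_inter A C) (svn_inter B D).
Proof. by apply: svn_setP => u /=; rewrite (minACA, maxACA). Qed.

Lemma svn_interUK A B : svn_inter A (svn_union A B) = A.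
Proof. by apply: svn_setP => u /=; rewrite (maxKx, minKx). Qed.

Lemma svn_unionIl A B C :
  svn_union (svn_inter A B) C = svn_inter (svn_union A C) (svn_union B C).
Proof. by apply: svn_setP => u /=; rewrite (max_minl, min_maxl). Qed.

Lemma svn_union_idPr A B : svn_sub A B -> svn_union A B = B.
Proof.
by move=> AB; apply: svn_setP => u /=; case: (AB u) => mAB iAB nAB;
  [exact: max_r | exact: max_r | exact: min_r].
Qed.

Lemma svn_subUl A B : svn_sub A (svn_union A B).
Proof. by move=> u; rewrite /= !le_max ge_min !lexx. Qed.

Lemma svn_subUr A B : svn_sub A (svn_union B A).
Proof. by move=> u; rewrite /= !le_max ge_min !lexx !orbT. Qed.

Lemma svn_subI2 A B C D :
  svn_sub A B -> svn_sub C D -> svn_sub (svn_inter A C) (svn_inter B D).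
Proof.
move=> AB CD u; case: (AB u) (CD u) => mAB iAB nAB [mCD iCD nCD].
by split; [exact: le_min2 | exact: le_min2 | exact: le_max2].
Qed.

Lemma svn_filter_base_join (F G : set (svn_set R U)) :
  svn_filter_base F -> svn_filter_base G -> svn_meets F G ->
  svn_filter_base (svn_join F G).
Proof.
move=> [[A0 FA0] _ FI] [[B0 GB0] _ GI] [_ _ meetFG]; split.
- by exists (svn_inter A0 B0), A0 => //; exists B0.
(* If [svn_empty] were in the join, it would be some [svn_inter A B], which the meeting condition
   excludes. *)
- by case=> A FA [B GB]; exact: meetFG.
- move=> _ _ [A FA [B GB <-]] [A' FA' [B' GB' <-]].
  have [C FC CA] := FI _ _ FA FA'; have [D GD DB] := GI _ _ GB GB'.
  exists (svn_inter C D); first by exists C => //; exists D.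
  (* Regrouping separates the members of [F] from those of [G], so that [C] and [D] bound one factor
     each. *)
  by rewrite svn_interACA; exact: svn_subI2.
Qed.

Lemma svn_joinC (F G : set (svn_set R U)) : svn_join F G = svn_join G F.
Proof.
by apply/seteqP; split=> _ [A FA [B GB <-]]; exists B => //; exists A => //;
  exact: svn_interC.
Qed.

Lemma svn_join_finer (F G : set (svn_set R U)) :
  svn_filter G -> svn_finer (svn_join F G) F.
Proof.
move=> [[[B GB] _ _] Gup] A FA; exists A => //.
(* Any [B] in [G] will do: the union lies above [B], hence in [G]. *)
exists (svn_union A B); last exact: svn_interUK.
by apply: Gup GB _; exact: svn_subUr.
Qed.

End SVNLattice.

Theorem proposition3p21 (R : realType) (U : Type) (F G : set (svn_set R U))
    (hF : svn_filter_base F) (hG : svn_filter_base G) (hFG : svn_meets F G) :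
  svn_filter_base (svn_join F G) /\
  (svn_filter F -> svn_filter G ->
   [/\ svn_filter (svn_join F G),
       svn_finer (svn_join F G) F &
       svn_finer (svn_join F G) G]).
Proof.
have hJ := svn_filter_base_join hF hG hFG.
split=> // filF filG; split; first split=> //.
- move=> _ C [A FA [B GB <-]] IC.
  exists (svn_union A C); first exact: filF.2 FA (svn_subUl _ _).
  exists (svn_union B C); first exact: filG.2 GB (svn_subUl _ _).
  (* Distributivity read backwards turns the intersection into the union of [svn_inter A B] with
     [C], which is [C] by [IC]. *)
  by rewrite -svn_unionIl svn_union_idPr.
- exact: svn_join_finer.
- by rewrite svn_joinC; exact: svn_join_finer.
Qed.
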